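(* Let $T>0$, $\ell>0$. Let $a,f\in C([0,T]\times[-\ell,\ell]\times\mathbb{R}\times\mathbb{R})$ and $b(\cdot,\pm\ell,\cdot,\cdot),\,g(\cdot,\pm\ell,\cdot,\cdot)\in C([0,T]\times\mathbb{R}\times\mathbb{R})$ be real-valued with $a>0$ and $b(\cdot,\pm\ell,\cdot,\cdot)>0$. Suppose there are a number $B>0$ and a non-decreasing positive function $\Phi$ on $[0,\infty)$ with $\int_0^\infty\frac{dr}{\Phi(r)}=\infty$ such that $$z f(t,x,z,0)\le\Phi(|z|)|z|+B,\qquad z g(t,\pm\ell,z,p)\le\Phi(|z|)|z|+B,\qquad (t,x,z,p)\in\Omega_T\times\mathbb{R}\times\mathbb{R}.$$ Let $\phi$ be the increasing function determined by $\int_0^{\phi(\xi)}\frac{dr}{\Phi(r)}=\ln\xi$, and for a given initial value $u^0$ set $$M:=\inf\left\{\phi(\xi)\,:\,\lambda>1,\ \xi=e^{\lambda T}\max\left\{1,\ \phi^{-1}\!\left(\frac{B}{(\lambda-1)\Phi(0)}\right),\ \phi^{-1}\big(|u^0|_{[-\ell,\ell]}\big)\right\}\right\}.$$ If $0<\tau\le T$ and $u$ is any classical solution on $\Omega_\tau$ to $$u_t-a(t,x,u,u_x)u_{xx}=f(t,x,u,u_x),\qquad (t,x)\in(0,\tau)\times(-\ell,\ell),$$ $$u_t\pm b(t,x,u,u_x)u_x=g(t,x,u,u_x),\qquad t\in(0,\tau),\ x=\pm\ell,$$ subject to $u(0,\cdot)=u^0$ on $[-\ell,\ell]$, then $|u|_{\Omega_\tau}\le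 M$.
   Context: $\Omega_\tau=(0,\tau)\times(-\ell,\ell)$; $|v|_S=\sup_S|v|$. The boundary condition with $\pm$ means two conditions, with $+$ at $x=\ell$ and $-$ at $x=-\ell$. A classical solution on $\Omega_\tau$ is a function $u\in C^{1,2}(\Omega_\tau)\cap C(\overline{\Omega}_\tau)$ (that is, $u$ is continuous on $\overline{\Omega}_\tau$ and has continuous derivatives $u_t,u_{xx}$ on $\Omega_\tau$) whose derivatives $u_t(\cdot,\pm\ell)$ and $u_x(\cdot,\pm\ell)$ are defined on $(0,\tau)$ and which satisfies the equation and the boundary conditions pointwise. In the definition of $M$ only the restriction of $\phi$ to $[1,\infty)$ is used: $\phi:[1,\infty)\to[0,\infty)$ is the increasing bijection with $\int_0^{\phi(\xi)}dr/\Phi(r)=\ln\xi$, so $\phi(1)=0$ and $\phi^{-1}(s)=\exp\big(\int_0^s dr/\Phi(r)\big)$ for $s\ge0$. *)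

(* Defs.v *)
From HB Require Import structures.
From mathcomp Require Import all_boot all_order all_algebra.
From mathcomp Require Import all_classical all_reals all_analysis.
Set Implicit Arguments.
Unset Strict Implicit.
Unset Printing Implicit Defensive.
Import Order.TTheory GRing.Theory Num.Theory.
Import numFieldNormedType.Exports.
Local Open Scope classical_set_scope.
Local Open Scope ring_scope.

(* The supremum is taken in R, so it is the usual one when S is nonempty and
   |f| is bounded on S, e.g. for f continuous on a compact set containing S. *)
Definition supnorm (R : realType) (X : Type) (S : set X) (f : X -> R) : R :=
  sup [set `|f x| | x in S].

Definition Omega (R : realType) (l tau : R) : set (R * R) :=
  `]0, tau[ `*` `](- l), l[.

Definition left_derivable (R : realType) (h : R -> R) (x : R) : Prop :=
  cvg ((h y - h x) / (y - x) @[y --> x^'-]).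

Definition left_derive (R : realType) (h : R -> R) (x : R) : R :=
  lim ((h y - h x) / (y - x) @[y --> x^'-]).

Definition right_derivable (R : realType) (h : R -> R) (x : R) : Prop :=
  cvg ((h y - h x) / (y - x) @[y --> x^'+]).

Definition right_derive (R : realType) (h : R -> R) (x : R) : R :=
  lim ((h y - h x) / (y - x) @[y --> x^'+]).

Definition u_t (R : realType) (u : R -> R -> R) (t x : R) : R :=
  derive1 (u ^~ x) t.

Definition u_x (R : realType) (u : R -> R -> R) (t x : R) : R :=
  derive1 (u t) x.

Definition u_xx (R : realType) (u : R -> R -> R) (t x : R) : R :=
  derive1n 2 (u t) x.

(* Functions on the closed cylinder are represented by total functions
   R -> R -> R; every clause below depends only on the values of u on the
   closure of Omega l tau.  In particular u_x (t, l) is a left derivative and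
   u_x (t, -l) a right derivative. *)
Record regular (R : realType) (l tau : R) (u : R -> R -> R) : Prop := {
  regular_cont :
    {within closure (Omega l tau), continuous (fun q : R * R => u q.1 q.2)} ;
  regular_ut : forall t x, Omega l tau (t, x) -> derivable (u ^~ x) t 1 ;
  regular_ux : forall t x, Omega l tau (t, x) -> derivable (u t) x 1 ;
  regular_uxx : forall t x, Omega l tau (t, x) -> derivable (derive1 (u t)) x 1 ;
  regular_ut_cont :
    {within Omega l tau, continuous (fun q : R * R => u_t u q.1 q.2)} ;
  regular_uxx_cont :
    {within Omega l tau, continuous (fun q : R * R => u_xx u q.1 q.2)} ;
  regular_ut_right : forall t, 0 < t < tau -> derivable (u ^~ l) t 1 ;
  regular_ut_left : forall t, 0 < t < tau -> derivable (u ^~ (- l)) t 1 ;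
  regular_ux_right : forall t, 0 < t < tau -> left_derivable (u t) l ;
  regular_ux_left : forall t, 0 < t < tau -> right_derivable (u t) (- l)
}.

Record classical_solution (R : realType) (l tau : R)
    (a f b g : R -> R -> R -> R -> R) (u : R -> R -> R) : Prop := {
  solution_regular : regular l tau u ;
  solution_pde : forall t x, Omega l tau (t, x) ->
    u_t u t x - a t x (u t x) (u_x u t x) * u_xx u t x
      = f t x (u t x) (u_x u t x) ;
  solution_bc_right : forall t, 0 < t < tau ->
    let p := left_derive (u t) l in
    u_t u t l + b t l (u t l) p * p = g t l (u t l) p ;
  solution_bc_left : forall t, 0 < t < tau ->
    let p := right_derive (u t) (- l) in
    u_t u t (- l) - b t (- l) (u t (- l)) p * p = g t (- l) (u t (- l)) p
}.

(* phi xi is the s >= 0 with int_0^s dr / Phi r = ln xi; for Phi positive and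
   non-decreasing with int_0^oo dr / Phi r = +oo it exists and is unique for
   every xi >= 1 (the default value 0 is then never used). *)
Definition phi (R : realType) (Phi : R -> R) (xi : R) : R :=
  xget 0 [set s | 0 <= s /\
    \int[lebesgue_measure]_(r in `[0, s]) (Phi r)^-1 = ln xi].

(* The inverse of phi : [1, oo) -> [0, oo). *)
Definition phi_inv (R : realType) (Phi : R -> R) : R -> R :=
  'pinv_(fun=> 1) `[1, +oo[ (phi Phi).

Definition boundM (R : realType) (T l B : R) (Phi u0 : R -> R) : R :=
  inf [set phi Phi (expR (lambda * T) *
             Num.max 1 (Num.max (phi_inv Phi (B / ((lambda - 1) * Phi 0)))
                                (phi_inv Phi (supnorm `[(- l), l] u0))))
      | lambda in [set lambda : R | 1 < lambda]].

(* Main.v *)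
Require Import Defs.
From HB Require Import structures.
From mathcomp Require Import all_boot all_order all_algebra.
From mathcomp Require Import all_classical all_reals all_analysis.
From mathcomp Require Import measurable_realfun lra.
Import Order.TTheory GRing.Theory Num.Theory.
Import numFieldNormedType.Exports.
Local Open Scope classical_set_scope.
Local Open Scope ring_scope.

(* Write G(s) for the integral of 1/Phi over [0, s], so that phi^-1 = exp o G.
   Fix lambda > 1 and let (t0, x0) maximise G(|u|) - lambda t on a cylinder
   [0, t1] x [-l, l] with t1 < tau.  If t0 = 0 the maximum is controlled by u0.
   Otherwise put z = |u(t0, x0)| and s = sign u(t0, x0).  As x0 maximises
   |u(t0, .)|, the equation or the boundary condition bounds s u_t(t0, x0) by
   k(z), where k(r) = s f(t0, x0, s r, 0), or the same with g.  Since Phi may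
   jump at z, G need not be differentiable there; but comparison with t < t0
   gives s u_t >= lambda Phi(r) for every r < z, while r k(r) <= Phi(r) r + B
   and k is continuous, so letting r increase to z gives
   z (lambda - 1) Phi(0) <= B. *)

Set Implicit Arguments.
Unset Strict Implicit.

(** * The integral of [1 / Phi], and [phi] as its inverse up to a logarithm *)

Definition osgood (R : realType) (Phi : R -> R) (s : R) : R :=
  \int[lebesgue_measure]_(r in `[0, s]) (Phi r)^-1.

Lemma measurable_invr_nondecreasing (R : realType) (Phi : R -> R)
    (D : set R) :
  (forall r, 0 <= r -> 0 < Phi r) ->
  (forall r s, 0 <= r -> r <= s -> Phi r <= Phi s) ->
  measurable D -> D `<=` `[0, +oo[ ->
  measurable_fun D (fun r => (Phi r)^-1).
Proof.
move=> Phi_gt0 Phi_nd mD D0.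
(* [Phi] is monotone only on the half-line [r >= 0]; composing with [Num.max 0] gives a function
   monotone on all of [R]. *)
apply: (eq_measurable_fun (fun r : R => (Phi (Num.max 0 r))^-1)).
  by move=> r /set_mem /D0; rewrite /= in_itv/= andbT => r0; rewrite max_r.
apply: measurable_realfun.nonincreasing_measurable => // r s rs.
have m0 (x : R) : 0 <= Num.max 0 x by rewrite le_max lexx.
rewrite lef_pV2 ?posrE ?Phi_gt0 ?m0//; apply: Phi_nd; first exact: m0.
by rewrite ge_max !le_max lexx /= rs orbT.
Qed.

Lemma integrable_invr_nondecreasing (R : realType) (Phi : R -> R)
    (i : interval R) (s : R) :
  (forall r, 0 <= r -> 0 < Phi r) ->
  (forall r s, 0 <= r -> r <= s -> Phi r <= Phi s) ->
  [set` i] `<=` `[0, s] ->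
  lebesgue_measure.-integrable [set` i] (EFin \o (fun r => (Phi r)^-1)).
Proof.
move=> Phi_gt0 Phi_nd i0s.
have mi : measurable [set` i] by exact: measurable_itv.
apply: measurable_bounded_integrable => //.
- apply: (@le_lt_trans _ _ (lebesgue_measure (`[0, s]%classic : set R))).
    by apply: le_measure; rewrite ?inE//; exact: measurable_itv.
  by rewrite lebesgue_measure_itv/=; case: ifP => // _; rewrite -EFinB ltry.
- apply: measurable_invr_nondecreasing => // r /i0s /=.
  by rewrite !in_itv/= => /andP[->].
- exists (Phi 0)^-1; split; first exact: num_real.
  move=> M PM r /i0s /=; rewrite in_itv/= => /andP[r0 _].
  rewrite (le_trans _ (ltW PM))// gtr0_norm ?invr_gt0 ?Phi_gt0//.
  by rewrite lef_pV2 ?posrE ?Phi_gt0//; apply: Phi_nd.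
Qed.

Lemma osgood0 (R : realType) (Phi : R -> R) : osgood Phi 0 = 0.
Proof. by rewrite /osgood set_itv1 Rintegral_set1. Qed.

(** On []s, t]] the integrand lies between [1 / Phi t] and [1 / Phi s]. These secant bounds stand in
    for the derivative of [osgood], which may fail to exist where [Phi] jumps. *)
Lemma osgoodB_bounds (R : realType) (Phi : R -> R) (s t : R) :
  (forall r, 0 <= r -> 0 < Phi r) ->
  (forall r s, 0 <= r -> r <= s -> Phi r <= Phi s) ->
  0 <= s -> s <= t ->
  (t - s) / Phi t <= osgood Phi t - osgood Phi s <= (t - s) / Phi s.
Proof.
move=> Phi_gt0 Phi_nd s0 st.
have t0 : 0 <= t := le_trans s0 st.
have -> : osgood Phi t - osgood Phi s =
    \int[lebesgue_measure]_(r in `]s, t]) (Phi r)^-1.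
  apply: Rintegral_itvB; rewrite ?bnd_simp//.
  exact: (@integrable_invr_nondecreasing _ _ _ t).
have iPhi : lebesgue_measure.-integrable `]s, t]
    (EFin \o (fun r => (Phi r)^-1)).
  apply: (@integrable_invr_nondecreasing _ _ _ t) => // r /=.
  by rewrite !in_itv/= => /andP[sr ->]; rewrite (le_trans s0 (ltW sr)).
have mst : measurable (`]s, t]%classic : set R) by exact: measurable_itv.
have mu_st : fine (lebesgue_measure (`]s, t]%classic : set R)) = t - s.
  rewrite lebesgue_measure_itv/= lte_fin; case: ltgtP st => // -> _.
  by rewrite subrr.
have mu_fin : (lebesgue_measure (`]s, t]%classic : set R) < +oo)%E.
  by rewrite lebesgue_measure_itv/=; case: ifP => // _; rewrite -EFinB ltry.
have icst c : lebesgue_measure.-integrable `]s, t]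
    (EFin \o (fun=> c : R)).
  apply: measurable_bounded_integrable => //.
  exists `|c|; split; first exact: num_real.
  by move=> M cM r _; exact: ltW.
have icstE c : \int[lebesgue_measure]_(r in `]s, t]) c = (t - s) * c.
  by rewrite Rintegral_cst// mu_st mulrC.
apply/andP; split; rewrite -icstE; apply: le_Rintegral => // r /=;
  rewrite in_itv/= => /andP[/ltW sr rt]; have r0 := le_trans s0 sr;
  by rewrite lef_pV2 ?posrE ?Phi_gt0// Phi_nd.
Qed.

Lemma osgood_lt (R : realType) (Phi : R -> R) (s t : R) :
  (forall r, 0 <= r -> 0 < Phi r) ->
  (forall r s, 0 <= r -> r <= s -> Phi r <= Phi s) ->
  0 <= s -> s < t -> osgood Phi s < osgood Phi t.
Proof.
move=> Phi_gt0 Phi_nd s0 st.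
have /andP[+ _] := osgoodB_bounds Phi_gt0 Phi_nd s0 (ltW st).
rewrite -subr_gt0; apply: lt_le_trans.
by rewrite divr_gt0 ?subr_gt0// Phi_gt0// (le_trans s0 (ltW st)).
Qed.

Lemma le_osgood (R : realType) (Phi : R -> R) (s t : R) :
  (forall r, 0 <= r -> 0 < Phi r) ->
  (forall r s, 0 <= r -> r <= s -> Phi r <= Phi s) ->
  0 <= s -> 0 <= t -> (osgood Phi s <= osgood Phi t) = (s <= t).
Proof.
move=> Phi_gt0 Phi_nd s0 t0; case: (leP s t) => [|ts].
  rewrite le_eqVlt => /predU1P[->|st]; first by rewrite lexx.
  by apply/ltW/osgood_lt.
by apply/negbTE; rewrite -ltNge; apply: osgood_lt.
Qed.

Lemma osgood_ge0 (R : realType) (Phi : R -> R) (s : R) :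
  (forall r, 0 <= r -> 0 < Phi r) ->
  (forall r s, 0 <= r -> r <= s -> Phi r <= Phi s) ->
  0 <= s -> 0 <= osgood Phi s.
Proof. by move=> P0 Pn s0; rewrite -(osgood0 Phi) le_osgood. Qed.

(** The secant bounds make [osgood Phi] Lipschitz with constant [1 / Phi 0] on the half-line. The
    absolute value extends this to [R], as needed for the composition with [u]. *)
Lemma continuous_osgood_norm (R : realType) (Phi : R -> R) :
  (forall r, 0 <= r -> 0 < Phi r) ->
  (forall r s, 0 <= r -> r <= s -> Phi r <= Phi s) ->
  continuous (fun z : R => osgood Phi `|z|).
Proof.
move=> Phi_gt0 Phi_nd.
have Phi00 : 0 < Phi 0 by exact: Phi_gt0.
have lip (s t : R) : 0 <= s -> s <= t ->
    `|osgood Phi t - osgood Phi s| <= (t - s) / Phi 0.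
  move=> s0 st; rewrite ger0_norm; last first.
    by rewrite subr_ge0 le_osgood// (le_trans s0 st).
  have /andP[_ /le_trans] := osgoodB_bounds Phi_gt0 Phi_nd s0 st; apply.
  rewrite ler_wpM2l ?subr_ge0// lef_pV2 ?posrE ?Phi_gt0//; exact: Phi_nd.
have lipn (x y : R) :
    `|osgood Phi `|x| - osgood Phi `|y| | <= `|x - y| / Phi 0.
  wlog yx : x y / `|y| <= `|x| => [H|].
    case/orP: (le_total `|y| `|x|) => [|/H]; first exact: H.
    by rewrite distrC (distrC y).
  apply: (le_trans (lip _ _ (normr_ge0 y) yx)).
  by rewrite ler_pM2r ?invr_gt0// lerB_dist.
move=> x; apply/cvgrPdist_le => e e0; near=> y.
apply: (le_trans (lipn x y)); rewrite ler_pdivrMr//.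
near: y; apply: cvgr_dist_le; last exact: mulr_gt0.
exact: cvg_id.
Unshelve. all: by end_near. Qed.

Lemma osgood_unbounded (R : realType) (Phi : R -> R) (C : R) :
  (forall r, 0 <= r -> 0 < Phi r) ->
  (forall r s, 0 <= r -> r <= s -> Phi r <= Phi s) ->
  (\int[lebesgue_measure]_(r in `[0%R, +oo[) ((Phi r)^-1)%:E = +oo)%E ->
  exists2 s, 0 <= s & C <= osgood Phi s.
Proof.
move=> Phi_gt0 Phi_nd Phi_div; apply: contrapT => noC.
have bnd s : 0 <= s -> osgood Phi s <= C.
  move=> s0; rewrite leNgt; apply/negP => Cs; apply: noC.
  by exists s => //; exact: ltW.
(* Monotone convergence along the intervals [[0, n]]: if every [osgood Phi n] were at most [C], the
   divergent integral would be too. *)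
pose F (n : nat) : set R := `[0, n%:R]%classic.
have F0 n : F n `<=` `[0, +oo[.
  by move=> r; rewrite /F /= !in_itv/= => /andP[->].
have bigF : \bigcup_i F i = `[0, +oo[%classic.
  apply/seteqP; split => [r [n _] /F0//|r /=]; rewrite in_itv/= andbT => r0.
  exists (Num.bound r) => //; rewrite /F /= in_itv/= r0/= ltW//.
  by have := archi_boundP r0.
have cvgF : (\int[lebesgue_measure]_(x in F i) ((Phi x)^-1)%:E)%E
    @[i --> \oo] --> (+oo : \bar R)%E.
  rewrite -Phi_div -bigF; apply: ge0_nondecreasing_set_cvg_integral.
  - move=> m n mn; apply/subsetPset => r; rewrite /F /= !in_itv/=.
    by move=> /andP[-> /le_trans]; apply; rewrite ler_nat.
  - by move=> n; exact: measurable_itv.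
  - move=> n; apply/measurable_EFinP.
    apply: measurable_invr_nondecreasing => //.
    exact: measurable_itv.
  - move=> n r /F0; rewrite /= in_itv/= andbT => r0.
    by rewrite lee_fin invr_ge0 ltW// Phi_gt0.
have : (+oo <= C%:E :> \bar R)%E.
  apply: (cvge_to_le cvgF); near=> n.
  have n0 : 0 <= n%:R :> R by [].
  rewrite -[leLHS]fineK ?lee_fin; first exact: bnd.
  apply: integrable_fin_num; first exact: measurable_itv.
  exact: (@integrable_invr_nondecreasing _ _ _ n%:R).
by rewrite leye_eq.
Unshelve. all: by end_near. Qed.

Lemma osgood_surj (R : realType) (Phi : R -> R) (c : R) :
  (forall r, 0 <= r -> 0 < Phi r) ->
  (forall r s, 0 <= r -> r <= s -> Phi r <= Phi s) ->
  (\int[lebesgue_measure]_(r in `[0%R, +oo[) ((Phi r)^-1)%:E = +oo)%E ->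
  0 <= c -> exists2 s, 0 <= s & osgood Phi s = c.
Proof.
move=> Phi_gt0 Phi_nd Phi_div c0.
have [b b0 cb] := @osgood_unbounded _ _ c Phi_gt0 Phi_nd Phi_div.
(* Intermediate value theorem between [osgood Phi 0 = 0] and a point [b] where [osgood Phi] has
   reached [c]. *)
have [||s _ <-] := @IVT _ (fun z => osgood Phi `|z|) 0 b c b0.
- by apply: continuous_subspaceT; exact: continuous_osgood_norm.
- by rewrite normr0 osgood0 ger0_norm// ge_min c0 le_max cb orbT.
- by exists `|s|.
Qed.

(** As [ln xi >= 0], surjectivity of [osgood Phi] makes the set in the definition of [phi] nonempty,
    so [xget] picks a true solution and not its default. *)
Lemma phiP (R : realType) (Phi : R -> R) (xi : R) :
  (forall r, 0 <= r -> 0 < Phi r) ->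
  (forall r s, 0 <= r -> r <= s -> Phi r <= Phi s) ->
  (\int[lebesgue_measure]_(r in `[0%R, +oo[) ((Phi r)^-1)%:E = +oo)%E ->
  1 <= xi -> 0 <= phi Phi xi /\ osgood Phi (phi Phi xi) = ln xi.
Proof.
move=> Phi_gt0 Phi_nd Phi_div xi1; rewrite /phi; apply: (@xgetPex _ 0
  [set s | 0 <= s /\ osgood Phi s = ln xi]).
have [s s0 sE] := osgood_surj Phi_gt0 Phi_nd Phi_div (ln_ge0 xi1).
by exists s.
Qed.

(** [phi] is injective on [[1, +oo[] and sends [expR (osgood Phi s)] to [s], so the partial inverse
    is the true one at [s]. *)
Lemma phi_invE (R : realType) (Phi : R -> R) (s : R) :
  (forall r, 0 <= r -> 0 < Phi r) ->
  (forall r s, 0 <= r -> r <= s -> Phi r <= Phi s) ->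
  (\int[lebesgue_measure]_(r in `[0%R, +oo[) ((Phi r)^-1)%:E = +oo)%E ->
  0 <= s -> phi_inv Phi s = expR (osgood Phi s).
Proof.
move=> Phi_gt0 Phi_nd Phi_div s0.
have in1 x : (x \in `[1, +oo[%classic) = (1 <= x :> R).
  by rewrite mem_setE in_itv/= andbT.
have exp1 : 1 <= expR (osgood Phi s).
  by rewrite -expR0 ler_expR osgood_ge0.
have phi_inj : {in `[1, +oo[%classic &, injective (phi Phi)}.
  move=> x y; rewrite !in1 => x1 y1 xy.
  have [_ xE] := phiP Phi_gt0 Phi_nd Phi_div x1.
  have [_ yE] := phiP Phi_gt0 Phi_nd Phi_div y1.
  apply: ln_inj; rewrite ?posrE ?(lt_le_trans ltr01)//.
  by rewrite -xE xy yE.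
have phi_exp : phi Phi (expR (osgood Phi s)) = s.
  have [p0] := phiP Phi_gt0 Phi_nd Phi_div exp1; rewrite expRK => pE.
  by apply/eqP; rewrite eq_le -(le_osgood Phi_gt0 Phi_nd p0 s0)
    -(le_osgood Phi_gt0 Phi_nd s0 p0) pE lexx.
by rewrite /phi_inv -{1}phi_exp pinvKV// in1.
Qed.

(** * Difference quotients and the second derivative test *)

Lemma derivable_cvg_slope (R : realType) (h : R -> R) (x : R) :
  derivable h x 1 ->
  (h y - h x) / (y - x) @[y --> x^'] --> derive1 h x.
Proof.
move=> dh.
have {}dh : k^-1 *: (h (k + x) - h x) @[k --> 0^'] --> derive1 h x.
  rewrite derive1E; move: dh; rewrite /derivable /derive/=.
  by under eq_fun do rewrite [_ *: 1]mulr1.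
apply/cvgrPdist_le => e e0; have /cvgrPdist_le/(_ e e0) := dh.
rewrite !near_withinE !nearE /= => /nbhs_ballP[d /= d0 de].
apply/nbhs_ballP; exists d => //= y xy yx.
have := de (y - x); rewrite subrK mulrC; apply.
- by rewrite /ball/= sub0r opprB.
- by rewrite subr_eq0.
Qed.

Lemma left_slope_le (R : realType) (h : R -> R) (a x c m : R) :
  a < x -> (h y - h x) / (y - x) @[y --> x^'-] --> m ->
  (forall y, a < y -> y < x -> c * (x - y) <= h x - h y) -> c <= m.
Proof.
move=> ax hm hc; apply: (cvgr_to_ge hm); near=> y.
have yx : y < x by near: y; exact: nbhs_left_lt.
have ay : a < y by near: y; exact: nbhs_left_gt.
rewrite -mulrNN -invrN !opprB ler_pdivlMr ?subr_gt0//.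
exact: hc.
Unshelve. all: by end_near. Qed.

(** If [s * h''(x)] were positive, [s * h'] would be positive just to the right of its zero [x], and
    the mean value theorem would give a larger value of [s * h] there. The factor [s] treats maxima
    and minima together. *)
Lemma second_derivative_max (R : realType) (h : R -> R) (a b x s : R) :
  s != 0 -> x \in `]a, b[ ->
  (forall y, y \in `]a, b[ -> derivable h y 1) ->
  derivable (derive1 h) x 1 ->
  (forall y, y \in `]a, b[ -> s * h y <= s * h x) ->
  derive1 h x = 0 /\ s * derive1n 2 h x <= 0.
Proof.
move=> s0 xab dh ddh hmax.
have ab : a <= b by move: xab; rewrite in_itv/= => /andP[/lt_trans H /H /ltW].
have sdh y : y \in `]a, b[ -> is_derive y 1 (s \*: h) (s *: derive1 h y).
  by move=> /dh /derivableP; rewrite derive1E => ?; exact: is_deriveZ.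
have hx0 : derive1 h x = 0.
  have [_ Dmax] := @derive1_at_max _ (s \*: h) a b x ab
    (fun y yab => @ex_derive _ _ _ _ _ _ _ (sdh y yab)) xab hmax.
  have [_] := sdh x xab; rewrite Dmax => /esym/eqP.
  by rewrite scaler_eq0 (negbTE s0) => /eqP.
split=> //; rewrite leNgt; apply/negP => h2.
have /derivable_cvg_slope/cvg_dnbhs_at_right := ddh.
rewrite hx0 => slope.
have {}slope : s * ((derive1 h y - 0) / (y - x)) @[y --> x^'+] -->
    s * derive1n 2 h x by apply: cvgM => //; exact: cvg_cst.
have : \forall y \near x^'+, 0 < s * ((derive1 h y - 0) / (y - x)).
  exact: (cvgr_gt _ slope).
rewrite near_withinE nearE /= => /nbhs_ballP[d /= d0 de].
(* The halves keep [z] strictly within distance [d] of [x] and strictly below [b]. *)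
pose z := Num.min (x + d / 2) ((x + b) / 2).
move: (xab); rewrite in_itv/= => /andP[ax xb].
have xz : x < z by rewrite lt_min; apply/andP; split; lra.
have zd : z <= x + d / 2 by rewrite ge_min lexx.
have zb : z < b by rewrite gt_min; apply/orP; right; lra.
have sub y : x <= y -> y <= z -> y \in `]a, b[.
  by move=> xy yz; rewrite in_itv/=; apply/andP; split; lra.
have dhz y : y \in `]x, z[ -> is_derive y 1 h (derive1 h y).
  rewrite in_itv/= => /andP[xy yz]; rewrite derive1E; apply: derivableP.
  by apply/dh/sub; exact: ltW.
have chz : {within `[x, z], continuous h}.
  apply: derivable_within_continuous => y; rewrite in_itv/= => /andP[xy yz].
  exact/dh/sub.
have [c + hE] := MVT xz dhz chz.
rewrite in_itv/= => /andP[xc cz].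
have := hmax z (sub z (ltW xz) (lexx z)).
apply/negP; rewrite -ltNge -subr_gt0 -mulrBr hE mulrA.
rewrite mulr_gt0 ?subr_gt0//.
have := de c; rewrite subr0 mulrA pmulr_lgt0 ?invr_gt0 ?subr_gt0//; apply=> //.
by rewrite /ball/= distrC ger0_norm; lra.
Qed.

(** * Continuity along curves and the closure of the cylinder *)

Lemma continuous_comp_within (R : realType) (X : topologicalType)
    (A : set X) (F : X -> R) (c : R -> X) :
  {within A, continuous F} -> continuous c -> (forall s, A (c s)) ->
  continuous (F \o c).
Proof.
move=> /subspace_continuousP FA cc cA s P /(FA _ (cA s)) FP.
by have := cc s _ FP; apply: (@filterS _ _ (nbhs_filter s)) => r /(_ (cA r)).
Qed.

Lemma subset_closure_Omega (R : realType) (l tau : R) : 0 < l -> 0 < tau ->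
  `[0, tau] `*` `[- l, l] `<=` closure (Omega l tau).
Proof.
move=> l0 tau0 [t x] [/= ]; rewrite !in_itv/= => /andP[t0 tt] /andP[lx xl].
(* The segment from [(t, x)] to the centre [(tau / 2, 0)] lies in the open cylinder for
   [0 < e < 1]. *)
pose c (e : R) := ((1 - e) * t + e * (tau / 2), (1 - e) * x).
have cc : c e @[e --> 0^'+] --> (t, x).
  have -> : (t, x) = c 0 by rewrite /c subr0 !mul1r mul0r addr0.
  apply: cvg_at_right_filter; have c1 : 1 - e @[e --> (0 : R)] --> 1 - (0 : R).
    by apply: cvgB; [exact: cvg_cst|exact: cvg_id].
  apply: (@cvg_pair _ _ _ _ (nbhs ((1 - 0) * t + 0 * (tau / 2)))
    (nbhs ((1 - 0) * x))).
    by apply: cvgD; apply: cvgM => //; exact: cvg_cst.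
  by apply: cvgM => //; exact: cvg_cst.
apply: (closed_cvg _ (@closed_closure _ (Omega l tau)) _ _ cc).
near=> e; apply: subset_closure.
have e0 : 0 < e by near: e; exact: nbhs_right_gt.
have e1 : e < 1 by near: e; exact: nbhs_right_lt.
by split; rewrite /= in_itv/=; apply/andP; split; nra.
Unshelve. all: by end_near. Qed.

(** * Inequalities at a maximum point *)

Lemma osgood_time_slope (R : realType) (Phi w : R -> R) (t0 lambda r : R) :
  (forall r, 0 <= r -> 0 < Phi r) ->
  (forall r s, 0 <= r -> r <= s -> Phi r <= Phi s) ->
  0 < t0 -> 0 < lambda -> derivable w t0 1 -> 0 < r -> r < w t0 ->
  (forall t, 0 < t -> t < t0 -> osgood Phi `|w t| - lambda * t <=
                      osgood Phi (w t0) - lambda * t0) ->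
  lambda * Phi r <= derive1 w t0.
Proof.
move=> Phi_gt0 Phi_nd t00 lambda0 dw r0 rw wmax.
have cw : {for t0, continuous w}.
  exact/differentiable_continuous/derivable1_diffP.
have : \forall t \near t0, r < w t by exact: (cvgr_gt _ cw).
move=> /nbhs_ballP[d /= d0 dr].
(* Within [d] of [t0] the values of [w] exceed [r], so there [osgood Phi] has secant slopes at most
   [1 / Phi r]. Since it must grow by [lambda * (t0 - t)], [w] grows by at least
   [lambda * Phi r * (t0 - t)]. *)
apply: (@left_slope_le _ w (Num.max 0 (t0 - d)) t0).
- by rewrite gt_max t00; lra.
- exact: cvg_dnbhs_at_left (derivable_cvg_slope dw).
- move=> t; rewrite gt_max => /andP[t1 td] tt0.
  have rwt : r < w t by apply: dr; rewrite /ball/= ger0_norm; lra.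
  have wt0 : 0 <= w t by lra.
  have := wmax t t1 tt0; rewrite ger0_norm// => wm.
  have Gd : lambda * (t0 - t) <= osgood Phi (w t0) - osgood Phi (w t) by lra.
  have wlt : w t <= w t0.
    by rewrite -(le_osgood Phi_gt0 Phi_nd)//; [nra|lra].
  have /andP[_ Gu] := osgoodB_bounds Phi_gt0 Phi_nd wt0 wlt.
  have Pr0 : 0 < Phi r by apply: Phi_gt0; exact: ltW.
  rewrite mulrAC -ler_pdivlMr//; apply: (le_trans Gd); apply: (le_trans Gu).
  apply: ler_wpM2l; first by rewrite subr_ge0.
  rewrite lef_pV2 ?posrE ?Phi_gt0 ?(ltW r0)//.
  by rewrite Phi_nd ?(ltW r0) ?(ltW rwt).
Qed.

(** Eliminating [Phi r] between the last two hypotheses gives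
    [lambda * (r * k r) - D * r <= lambda * B], whose left side is continuous in [r]. At [r = z],
    use [D <= k z] and then [lambda * Phi 0 <= D]. *)
Lemma growth_bound (R : realType) (Phi k : R -> R) (z D lambda B : R) :
  (forall r, 0 <= r -> 0 < Phi r) ->
  (forall r s, 0 <= r -> r <= s -> Phi r <= Phi s) ->
  continuous k -> 0 < z -> 1 < lambda -> D <= k z ->
  (forall r, 0 < r -> r < z -> r * k r <= Phi r * r + B) ->
  (forall r, 0 < r -> r < z -> lambda * Phi r <= D) ->
  z <= B / ((lambda - 1) * Phi 0).
Proof.
move=> Phi_gt0 Phi_nd ck z0 lambda1 Dk kB PhiD.
have Phi00 : 0 < Phi 0 by exact: Phi_gt0.
have kz : lambda * (z * k z) - D * z <= lambda * B.
  have cvg_k : lambda * (r * k r) - D * r @[r --> z^'-] -->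
      lambda * (z * k z) - D * z.
    apply: cvg_at_left_filter; apply: cvgB.
      apply: cvgM; first exact: cvg_cst.
      by apply: cvgM; [exact: cvg_id|exact: ck].
    by apply: cvgM; [exact: cvg_cst|exact: cvg_id].
  apply: (cvgr_to_le cvg_k); near=> r.
  have r0 : 0 < r by near: r; exact: nbhs_left_gt.
  have rz : r < z by near: r; exact: nbhs_left_lt.
  have := kB r r0 rz; have := PhiD r r0 rz; nra.
have PD : lambda * Phi 0 <= D.
  have z20 : 0 < z / 2 by lra.
  apply: le_trans (PhiD (z / 2) z20 _); last by lra.
  by rewrite ler_pM2l ?Phi_nd//; lra.
rewrite ler_pdivlMr ?mulr_gt0 ?subr_gt0//.
have lambda0 := lt_trans ltr01 lambda1.
have zD : (lambda - 1) * (z * D) <= lambda * B.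
  have : lambda * (z * D) <= lambda * (z * k z) by rewrite !ler_pM2l.
  by lra.
have : (lambda - 1) * (z * (lambda * Phi 0)) <= (lambda - 1) * (z * D).
  by rewrite ler_pM2l ?subr_gt0// ler_pM2l.
move=> /le_trans/(_ zD) zPhi.
by rewrite -(ler_pM2l lambda0); lra.
Unshelve. all: by end_near. Qed.

Lemma continuous_pair (X Y Z : topologicalType) (c : X -> Y) (d : X -> Z) :
  continuous c -> continuous d -> continuous (fun q => (c q, d q)).
Proof. by move=> cc cd q; exact: cvg_pair (cc q) (cd q). Qed.

Lemma max_point_inequality (R : realType) (T l : R)
    (a f b g : R -> R -> R -> R -> R) (B : R) (Phi : R -> R) (tau : R)
    (u : R -> R -> R) (t x s : R) :
  0 < l ->
  {within `[0, T] `*` `[(- l), l] `*` [set: R] `*` [set: R],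
    continuous (fun y : R * R * R * R => f y.1.1.1 y.1.1.2 y.1.2 y.2)} ->
  (forall x, x = l \/ x = - l ->
    {within `[0, T] `*` [set: R] `*` [set: R],
    continuous (fun y : R * R * R => g y.1.1 x y.1.2 y.2)}) ->
  (forall t x z p, 0 <= t <= T -> - l <= x <= l -> 0 < a t x z p) ->
  (forall t x z p, 0 <= t <= T -> x = l \/ x = - l -> 0 < b t x z p) ->
  (forall t x z, Omega l T (t, x) -> z * f t x z 0 <= Phi `|z| * `|z| + B) ->
  (forall t x z p, 0 < t < T -> x = l \/ x = - l ->
    z * g t x z p <= Phi `|z| * `|z| + B) ->
  tau <= T -> classical_solution l tau a f b g u ->
  s * s = 1 -> 0 < t < tau -> - l <= x <= l ->
  (forall y, - l <= y <= l -> s * u t y <= s * u t x) ->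
  derivable (u ^~ x) t 1 /\
  exists k : R -> R, [/\ continuous k,
    s * u_t u t x <= k (s * u t x) &
    forall r, 0 < r -> r * k r <= Phi r * r + B].
Proof.
move=> l0 f_cont g_cont a_gt0 b_gt0 f_growth g_growth tauT [ureg pde bcr bcl].
move=> ss ttau xl umax.
have [t0 tt] := andP ttau.
have tT : 0 < t < T by rewrite t0 (lt_le_trans tt).
have tT' : 0 <= t <= T by case/andP: tT => /ltW -> /ltW ->.
have s0 : s != 0.
  by apply: contra_eq_neq ss => ->; rewrite mul0r eq_sym oner_neq0.
have s1 : `|s| = 1.
  by apply/eqP; rewrite -sqrp_eq1// expr2 -normrM ss normr1.
have sr r : 0 < r -> `|s * r| = r.
  by move=> r0; rewrite normrM s1 mul1r gtr0_norm.
have ssK (z : R) : s * (s * z) = z by rewrite mulrA ss mul1r.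
have smul_cont : continuous (fun q : R => s * q).
  by move=> q; apply: cvgM; [exact: cvg_cst|exact: cvg_id].
(* The growth condition on [g] holds for every [p], so the unknown one-sided derivative may be
   frozen there. *)
have boundary y p : y = l \/ y = - l ->
    continuous (fun r => s * g t y (s * r) p) /\
    forall r, 0 < r -> r * (s * g t y (s * r) p) <= Phi r * r + B.
  move=> yl; split=> [|r r0]; last first.
    by have := g_growth t y (s * r) p tT yl; rewrite sr// mulrA (mulrC r).
  move=> r; apply: cvgM; first exact: cvg_cst.
  apply: (@continuous_comp_within _ _ _ _ (fun r : R => (t, s * r, p))
    (g_cont y yl)).
    apply: continuous_pair (@cst_continuous _ _ p).
    exact: continuous_pair (@cst_continuous _ _ t) smul_cont.
  by move=> q; split=> //=; split=> //=; rewrite in_itv.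
have : x = l \/ x = - l \/ - l < x < l.
  have [|xNl] := eqVneq x l; first by left.
  have [|xNnl] := eqVneq x (- l); first by right; left.
  by right; right; rewrite !lt_neqAle xNl eq_sym xNnl.
move=> [xE|[xE|xI]].
- have [ck kB] := boundary l (left_derive (u t) l) (or_introl erefl).
  rewrite xE in umax *; split; first exact: regular_ut_right ureg _ ttau.
  exists (fun r => s * g t l (s * r) (left_derive (u t) l)).
  (* The boundary condition reduces the claim to [0 <= b * (s * p)]; [s * p] is a limit of left
     quotients of [s * u], which are nonnegative since the maximum is at [l]. *)
  split=> //; rewrite ssK -(bcr _ ttau) /= mulrDr lerDl mulrCA.
  apply: mulr_ge0; first by apply/ltW/b_gt0 => //; left.
  have /(cvgM (cvg_cst s)) := regular_ux_right ureg ttau.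
  rewrite -[lim _]/(left_derive (u t) l) => slope.
  apply: (cvgr_to_ge slope); near=> y.
  have yl : y < l by near: y; exact: nbhs_left_lt.
  have ly : - l < y by near: y; apply: nbhs_left_gt; lra.
  rewrite -[leRHS]/(s * ((u t y - u t l) / (y - l))) mulrA mulrBr.
  apply: mulr_le0; first by rewrite subr_le0; apply: umax; rewrite !ltW.
  by rewrite invr_le0 subr_le0 ltW.
- have [ck kB] := boundary (- l) (right_derive (u t) (- l)) (or_intror erefl).
  rewrite xE in umax *; split; first exact: regular_ut_left ureg _ ttau.
  exists (fun r => s * g t (- l) (s * r) (right_derive (u t) (- l))).
  (* At [- l] both signs flip: right quotients from a maximum are nonpositive, and the term with [b]
     carries a minus. *)
  split=> //; rewrite ssK -(bcl _ ttau) /= mulrBr lerDl oppr_ge0 mulrCA.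
  apply: mulr_ge0_le0; first by apply/ltW/b_gt0 => //; right.
  have /(cvgM (cvg_cst s)) := regular_ux_left ureg ttau.
  rewrite -[lim _]/(right_derive (u t) (- l)) => slope.
  apply: (cvgr_to_le slope); near=> y.
  have ly : - l < y by near: y; exact: nbhs_right_gt.
  have yl : y < l by near: y; apply: nbhs_right_lt; lra.
  rewrite -[leLHS]/(s * ((u t y - u t (- l)) / (y - - l))) mulrA mulrBr.
  apply: mulr_le0_ge0.
    by rewrite subr_le0; apply: umax; rewrite !ltW.
  by rewrite invr_ge0 subr_ge0 ltW.
- have Otx y : - l < y < l -> Omega l tau (t, y).
    by move=> yl; split; rewrite /= in_itv.
  split; first exact: regular_ut ureg _ _ (Otx _ xI).
  have [ux0 uxx] : derive1 (u t) x = 0 /\ s * derive1n 2 (u t) x <= 0.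
    apply: (@second_derivative_max _ _ (- l) l) => //.
    - by move=> y; rewrite in_itv/= => /Otx; exact: regular_ux ureg _ _.
    - exact: regular_uxx ureg _ _ (Otx _ xI).
    - by move=> y; rewrite in_itv/= => /andP[/ltW ? /ltW ?]; apply/umax/andP.
  exists (fun r => s * f t x (s * r) 0); split.
  + move=> r; apply: cvgM; first exact: cvg_cst.
    apply: (@continuous_comp_within _ _ _ _ (fun r : R => (t, x, s * r, 0))
      f_cont).
      apply: continuous_pair (@cst_continuous _ _ 0).
      exact: continuous_pair (@cst_continuous _ _ (t, x)) smul_cont.
    by move=> q; split=> //=; split=> //=; split; rewrite /= in_itv.
  + have := pde t x (Otx _ xI); rewrite ssK /u_x ux0 => <-.
    rewrite mulrBr lerDl oppr_ge0 mulrCA mulr_ge0_le0//.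
    by apply/ltW/a_gt0.
  + move=> r r0; have : Omega l T (t, x) by split; rewrite /= in_itv.
    by move=> /(f_growth t x (s * r)); rewrite sr// mulrA (mulrC r).
Unshelve. all: by end_near. Qed.

(** * The maximum argument on a truncated cylinder *)

Unset Implicit Arguments.
Set Strict Implicit.

Theorem proposition3p7 (R : realType) (T l : R) (T_gt0 : 0 < T) (l_gt0 : 0 < l)
  (a f b g : R -> R -> R -> R -> R)
  (a_cont : {within `[0, T] `*` `[(- l), l] `*` [set: R] `*` [set: R],
    continuous (fun y : R * R * R * R => a y.1.1.1 y.1.1.2 y.1.2 y.2)})
  (f_cont : {within `[0, T] `*` `[(- l), l] `*` [set: R] `*` [set: R],
    continuous (fun y : R * R * R * R => f y.1.1.1 y.1.1.2 y.1.2 y.2)})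
  (b_cont : forall x, x = l \/ x = - l ->
    {within `[0, T] `*` [set: R] `*` [set: R],
    continuous (fun y : R * R * R => b y.1.1 x y.1.2 y.2)})
  (g_cont : forall x, x = l \/ x = - l ->
    {within `[0, T] `*` [set: R] `*` [set: R],
    continuous (fun y : R * R * R => g y.1.1 x y.1.2 y.2)})
  (a_gt0 : forall t x z p, 0 <= t <= T -> - l <= x <= l -> 0 < a t x z p)
  (b_gt0 : forall t x z p, 0 <= t <= T -> x = l \/ x = - l -> 0 < b t x z p)
  (B : R) (B_gt0 : 0 < B) (Phi : R -> R)
  (Phi_gt0 : forall r, 0 <= r -> 0 < Phi r)
  (Phi_nondecr : forall r s, 0 <= r -> r <= s -> Phi r <= Phi s)
  (Phi_div :
    (\int[lebesgue_measure]_(r in `[0%R, +oo[) ((Phi r)^-1)%:E = +oo)%E)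
  (f_growth : forall t x z, Omega l T (t, x) ->
    z * f t x z 0 <= Phi `|z| * `|z| + B)
  (g_growth : forall t x z p, 0 < t < T -> x = l \/ x = - l ->
    z * g t x z p <= Phi `|z| * `|z| + B)
  (u0 : R -> R) (tau : R) (tau_gt0 : 0 < tau) (tau_le : tau <= T)
  (u : R -> R -> R) (u_sol : classical_solution l tau a f b g u)
  (u_init : forall x, - l <= x <= l -> u 0 x = u0 x) :
  supnorm (Omega l tau) (fun q => u q.1 q.2) <= boundM T l B Phi u0.
Proof.
apply: ge_sup.
  exists `|u (tau / 2) 0|; exists (tau / 2, 0) => //.
  by split; rewrite /= ?in_itv/=; apply/andP; split; lra.
move=> _ [[t1 x1] [/= + +] <-]; rewrite !in_itv/=.
move=> /andP[t10 t1tau] /andP[lx1 x1l].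
(* The choice [lambda = 2] shows that the infimum is over a nonempty set; it remains to bound [u]
   for each fixed [lambda]. *)
apply: lb_le_inf; first by eexists; exists 2; [rewrite /= ltr1n|reflexivity].
move=> _ [lambda /= lambda1 <-].
have lambda0 := lt_trans ltr01 lambda1.
(* Stopping at [t1 < tau] keeps a maximum point with [t0 > 0] at a time where the equation and the
   boundary conditions hold. *)
pose K : set (R * R) := `[0, t1] `*` `[- l, l].
have K_compact : compact K by apply: compact_setX; exact: segment_compact.
have u_cont : {within K, continuous (fun q : R * R => u q.1 q.2)}.
  apply: continuous_subspaceW (regular_cont (solution_regular u_sol)).
  apply: subset_trans (subset_closure_Omega l_gt0 tau_gt0) => -[t x] [/=].
  rewrite !in_itv/= => /andP[t0 tt1] xl; split; rewrite /= ?in_itv/= ?xl// t0.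
  exact: le_trans tt1 (ltW t1tau).
have K1 : K (t1, x1) by split; rewrite /= ?in_itv/= ?lexx ?ltW.
have K0 : K !=set0 by exists (t1, x1).
have K_comp (h : R -> R) : continuous h ->
    {within K, continuous (fun q : R * R => h (u q.1 q.2))}.
  by move=> ch q; apply: continuous_comp; [exact: u_cont|exact: ch].
(* The real [sup] is an upper bound only of a bounded set; boundedness of [u0] comes from the
   continuity of [u] on the compact [K]. *)
have u0_le x : - l <= x <= l -> `|u 0 x| <= supnorm `[(- l), l] u0.
  move=> xl; apply: sup_upper_bound; last first.
    by exists x; rewrite /= ?in_itv// u_init.
  split; first by exists `|u0 x|; exists x; rewrite /= ?in_itv.
  have [q _ qmax] := compact_EVT_max K0 K_compact
    (K_comp _ (@norm_continuous _ R)).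
  exists `|u q.1 q.2| => _ [y /= yl <-].
  rewrite -u_init; last by rewrite in_itv in yl.
  by apply: (qmax (0, y)); rewrite inE; split; rewrite //= ?in_itv/= lexx ltW.
set N := supnorm _ u0 in u0_le *.
have N0 : 0 <= N by apply: le_trans (u0_le 0 _) => //; apply/andP; split; lra.
have Phi00 : 0 < Phi 0 by exact: Phi_gt0.
set C := B / _.
have C0 : 0 <= C by rewrite divr_ge0 ?mulr_ge0 ?subr_ge0 ?ltW.
rewrite !(phi_invE Phi_gt0 Phi_nondecr Phi_div)//.
set m := Num.max 1 _.
have m1 : 1 <= m by rewrite le_max lexx.
have m0 : 0 < m := lt_le_trans ltr01 m1.
(* After this, a bound by [C] or by [N] at the maximum point suffices. *)
have CN v : 0 <= v -> v <= C \/ v <= N -> osgood Phi v <= ln m.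
  move=> v0 vCN; rewrite -ler_expR lnK ?posrE// le_max; apply/orP; right.
  by rewrite le_max !ler_expR !(le_osgood Phi_gt0 Phi_nondecr)//; apply/orP.
have xi1 : 1 <= expR (lambda * T) * m.
  by apply: mulr_ege1 => //; rewrite -expR0 ler_expR mulr_ge0 ?ltW.
have [phi0 phiE] := phiP Phi_gt0 Phi_nondecr Phi_div xi1.
(* Applying the increasing [osgood Phi] turns the goal into a bound by [lambda * T + ln m]. *)
rewrite -(le_osgood Phi_gt0 Phi_nondecr)// phiE lnM ?posrE ?expR_gt0// expRK.
pose W (q : R * R) := osgood Phi `|u q.1 q.2| - lambda * q.1.
have W_cont : {within K, continuous W}.
  move=> q; apply: cvgB.
    exact: (K_comp _ (continuous_osgood_norm Phi_gt0 Phi_nondecr)).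
  apply: (@continuous_subspaceT _ _ K (fun q : R * R => lambda * q.1)) => p.
  by apply: cvgM; [exact: cvg_cst|exact: cvg_fst].
have [[t0 x0] + Wmax] := compact_EVT_max K0 K_compact W_cont.
rewrite inE => -[/=]; rewrite !in_itv/= => /andP[t00 t0t1] xl0.
suff : W (t0, x0) <= ln m.
  move=> Wm; have := le_trans (Wmax (t1, x1) (mem_set K1)) Wm.
  rewrite /W/= => W1.
  have : lambda * t1 <= lambda * T by rewrite ler_pM2l//; lra.
  by lra.
rewrite /W/=; have lt0 : 0 <= lambda * t0 by rewrite mulr_ge0// ltW.
move: t00; rewrite le_eqVlt => /predU1P[t0E|t00].
  rewrite -t0E mulr0 subr0; apply: CN => //; right.
  exact: u0_le.
apply: (@le_trans _ _ (osgood Phi `|u t0 x0|)); first by lra.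
(* Where [u] vanishes it has no sign to work with, but then [0 <= C] suffices. *)
have [uE|u_neq0] := eqVneq (u t0 x0) 0.
  by apply: CN => //; left; rewrite uE normr0.
pose s := Num.sg (u t0 x0).
have ss : s * s = 1 by rewrite -expr2 sqr_sg u_neq0.
have su : s * u t0 x0 = `|u t0 x0| by rewrite [RHS]normrEsg.
have s1 : `|s| = 1 by rewrite normr_sg u_neq0.
have s_le z : s * z <= `|z|.
  by rewrite (le_trans (ler_norm _))// normrM s1 mul1r.
(* At fixed time the penalty [lambda * t0] cancels, so [x0] maximises the absolute value of
   [u t0]. *)
have umax y : - l <= y <= l -> s * u t0 y <= s * u t0 x0.
  move=> yl; rewrite su; apply: (le_trans (s_le _)).
  have /Wmax : (t0, y) \in K.
    by rewrite inE; split; rewrite /= ?in_itv//= t0t1 ltW.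
  by rewrite /W/= lerD2r (le_osgood Phi_gt0 Phi_nondecr).
have t0tau : 0 < t0 < tau by rewrite t00 (le_lt_trans t0t1).
have [du [k [ck kD kB]]] := max_point_inequality l_gt0 f_cont g_cont a_gt0 b_gt0
  f_growth g_growth tau_le u_sol ss t0tau xl0 umax.
apply: CN => //; left.
have z0 : 0 < `|u t0 x0| by rewrite normr_gt0.
rewrite -su in z0 *.
apply: (growth_bound Phi_gt0 Phi_nondecr ck z0 lambda1 kD) => r r0 rz.
  exact: kB.
have dsu : is_derive t0 1 (s \*: (u ^~ x0)) (s *: derive1 (u ^~ x0) t0).
  by move: du => /derivableP; rewrite derive1E => ?; exact: is_deriveZ.
have -> : s * u_t u t0 x0 = derive1 (s \*: (u ^~ x0)) t0.
  by rewrite [RHS]derive1E; case: dsu => _ ->.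
(* Here [w] is [s * u] along the line [x = x0]; its hypothesis is the maximality of [W] compared
   with earlier times. *)
apply: osgood_time_slope => //.
move=> t t_gt0 tt0; rewrite -[(s \*: _) t0]/(s * u t0 x0) su.
rewrite -[(s \*: _) t]/(s * u t x0) normrM s1 mul1r.
have : (t, x0) \in K.
  rewrite inE; split; rewrite /= ?in_itv//= ltW//=.
  exact: le_trans (ltW tt0) t0t1.
by move=> /Wmax.
Qed.
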